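(* For every real $\phi$ with $0 \le \phi < \pi/6$, the algorithm $A_{AD}^{\phi}:\mathbb{R}^2\to\mathbb{R}^2$ (defined in the context) is a gathering algorithm for two oblivious robots with $\phi$-dynamic compasses under the asynchronous model; that is, for every initial configuration $C(0)$, every fair asynchronous execution of $A_{AD}^{\phi}$ by two robots with $\phi$-dynamic compasses starting from $C(0)$ is a gathering execution.
   Context: Robots. Two anonymous oblivious robots $r_0,r_1$ are points in $\mathbb{R}^2$, with position $\mathbf r_i(t)\in\mathbb{R}^2$ of $r_i$ at time $t$ in a global coordinate system $Z$. The configuration at time $t$ is $C(t)=(\mathbf r_0(t),\mathbf r_1(t))$. At time $t$ robot $r_i$ has a local coordinate system $Z_{(i,t)}$ given by $$Z_{(i,t)}(\mathbf p)^T = sc_i(t)\begin{pmatrix}\cos\phi_i(t)&\sin\phi_i(t)\\-\sin\phi_i(t)&\cos\phi_i(t)\end{pmatrix}(\mathbf p-\mathbf r_i(t))^T,$$ where the scaling ratio $sc_i(t)\in(0,\infty)$ and the compass deviation $\phi_i(t)\in(-\pi,\pi]$ are chosen by an adversary. (The scaling ratio may change from cycle to cycle.) Compasses. The compasses are $\phi$-dynamic if $|\phi_i(t)|\le\phi$ for $i\in\{0,1\}$ and all $t\in\mathbb{N}$ (where $0\in\mathbb N$); subject to this bound, $\phi_i(t)$ may change arbitrarily from one cycle of $r_i$ to the next (it is constant during a cycle). Algorithm and look-compute-move cycle. An algorithm is a total function $\psi:\mathbb{R}^2\to\mathbb{R}^2$, used by both robots. A robot $r_i$ activated at time $t\in\mathbb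 N$ observes the other robot $r_{1-i}$ instantaneously at time $t$, at local coordinates $\mathbf p=Z_{(i,t)}(\mathbf r_{1-i}(t))$ (the other robot may be in the middle of a move at that time), and then moves in a straight line from $\mathbf r_i(t)$ toward the point whose coordinates in the coordinate system $Z_{(i,t)}$ fixed at time $t$ are $\psi(\mathbf p)$ (its destination). The adversary may stop the move before the destination is reached, but the robot either reaches its destination or travels a distance at least $\delta$ (measured in $Z$) during the cycle, where $\delta>0$ is a fixed constant. Asynchronous execution. The adversary chooses the activation times (start times of cycles) of each robot; the set of times at which at least one robot is activated is $\mathbb N$. No assumption is made on the duration of a cycle: if $t<t'$ are consecutive activation times of $r_i$, then during $[t,t']$ robot $r_i$ progresses monotonically (with arbitrary, possibly variable, adversarially chosen finite speed, including arbitrary pauses) along the segment from $\mathbf r_i(t)$ toward its destination computed at $t$, and by time $t'$ it has reached the destination or travelled at least $\delta$. Before its first activation a robot does not move. An execution is the resulting infinite sequence $C(0),C(1),\dots$; it is required to be fair: each robot is activated infinitely many times. Gathering. An execution is a gathering execution if there are $\mathbf p\in\mathbb{R}^2$ and $f\in\mathbb N$ with $C(t)=(\mathbf p,\mathbf p)$ for all $t\ge f$. An algorithm is a gathering algorithm (it solves the gathering problem) if for every initial configuration $C(0)$, every execution starting from $C(0)$ is a gathering execution. Algorithm $A_{AD}^{\phi}$. For $\mathbf p\ne\mathbf 0$, $\arg(\mathbf p)$ is the polar angle of $\mathbf p$; angles are taken modulo $2\pi$. For an angle $\omega$, $\rho_\omega(\mathbf p)$ is the point obtained by rotating $\mathbf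 p$ counterclockwise by $\omega$ about $\mathbf 0$, i.e. $\rho_\omega(\mathbf p)^T=\begin{pmatrix}\cos\omega&-\sin\omega\\\sin\omega&\cos\omega\end{pmatrix}\mathbf p^T$. (Gathered) If $\mathbf p=\mathbf 0$ then $A_{AD}^{\phi}(\mathbf p)=\mathbf 0$. (Approach) If $2\pi/3+\phi\le\arg(\mathbf p)<3\pi/2$ then $A_{AD}^{\phi}(\mathbf p)=\mathbf p$. (Wait) If $-\pi/2\le\arg(\mathbf p)\le\pi/3-\phi$ then $A_{AD}^{\phi}(\mathbf p)=\mathbf 0$. (Rotate) If $\pi/3-\phi<\arg(\mathbf p)<2\pi/3+\phi$ then $A_{AD}^{\phi}(\mathbf p)=\rho_{\frac{2\pi}{3}+2\phi}(\mathbf p)$. *)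

(* Defs.v *)
From Stdlib Require Export Reals.
From Stdlib Require Import Lra ClassicalEpsilon.
Open Scope R_scope.

Definition point : Type := (R * R)%type.

Definition origin : point := (0, 0).

Definition dist (p q : point) : R := dist_euc (fst p) (snd p) (fst q) (snd q).

Definition rotate (w : R) (p : point) : point :=
  (cos w * fst p - sin w * snd p, sin w * fst p + cos w * snd p).

(* The branch of the polar angle with values in [-PI/2, 3*PI/2); the value at
   the origin is irrelevant. *)
Definition arg (p : point) : R :=
  let (x, y) := p in
  if Rlt_dec 0 x then atan (y / x)
  else if Rlt_dec x 0 then atan (y / x) + PI
  else if Rlt_dec 0 y then PI / 2
  else - PI / 2.

Lemma arg_range (p : point) : - PI / 2 <= arg p < 3 * PI / 2.
Proof.
destruct p as [x y]; unfold arg.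
pose proof (atan_bound (y / x)); pose proof PI_RGT_0.
repeat destruct Rlt_dec; lra.
Qed.

Lemma arg_spec (p : point) :
  p = (dist origin p * cos (arg p), dist origin p * sin (arg p)).
Proof.
destruct p as [x y]; unfold dist, dist_euc, origin; simpl fst; simpl snd.
replace (Rsqr (0 - x) + Rsqr (0 - y)) with (x * x + y * y)
  by (unfold Rsqr; ring).
assert (H : forall x, x <> 0 ->
  sqrt (x * x + y * y) = Rabs x * sqrt (1 + (y / x)²)).
{ intros z Hz.
  replace (z * z + y * y) with (z² * (1 + (y / z)²))
    by (unfold Rsqr; field; lra).
  rewrite sqrt_mult; [now rewrite sqrt_Rsqr_abs | apply Rle_0_sqr |].
  pose proof (Rle_0_sqr (y / z)); lra. }
assert (Hs : sqrt (1 + (y / x)²) <> 0).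
{ apply Rgt_not_eq, sqrt_lt_R0; pose proof (Rle_0_sqr (y / x)); lra. }
unfold arg; destruct (Rlt_dec 0 x) as [h|h]; [|destruct (Rlt_dec x 0) as [h'|h']].
- rewrite (H x) by lra; rewrite cos_atan, sin_atan, Rabs_pos_eq by lra.
  f_equal; field; repeat split; lra.
- rewrite (H x) by lra; rewrite neg_cos, neg_sin, cos_atan, sin_atan.
  rewrite Rabs_left by lra.
  f_equal; field; repeat split; lra.
- replace x with 0 in * by lra.
  replace (0 * 0 + y * y) with (y²) by (unfold Rsqr; ring).
  rewrite sqrt_Rsqr_abs; destruct (Rlt_dec 0 y).
  + rewrite cos_PI2, sin_PI2, Rabs_pos_eq by lra; f_equal; ring.
  + replace (- PI / 2) with (- (PI / 2)) by field.
    rewrite cos_neg, sin_neg, cos_PI2, sin_PI2, Rabs_left1 by lra.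
    f_equal; ring.
Qed.

(* By [arg_range], the last branch is PI/3 - phi < arg p < 2*PI/3 + phi. *)
Definition A_AD (phi : R) (p : point) : point :=
  if excluded_middle_informative (p = origin) then origin
  else if excluded_middle_informative
            (2 * PI / 3 + phi <= arg p < 3 * PI / 2) then p
  else if excluded_middle_informative
            (- PI / 2 <= arg p <= PI / 3 - phi) then origin
  else rotate (2 * PI / 3 + 2 * phi) p.

(* [false] is r_0 and [true] is r_1, so the other robot is [negb i]. *)
Definition robot : Type := bool.

Definition configuration : Type := (point * point)%type.

(* Global-to-local coordinate change of a robot at [o] with scaling ratio [s]
   and compass deviation [a]. *)
Definition local_coords (s a : R) (o p : point) : point :=
  (s * (cos a * (fst p - fst o) + sin a * (snd p - snd o)),
   s * (- sin a * (fst p - fst o) + cos a * (snd p - snd o))).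

Definition segment_point (p q : point) (l : R) : point :=
  (fst p + l * (fst q - fst p), snd p + l * (snd q - snd p)).

(* Robots move in continuous time; activations, scaling ratios and compass
   deviations are indexed by the natural times. *)
Record run : Type := Run {
  traj : robot -> R -> point;
  active : robot -> nat -> Prop;
  scaling : robot -> nat -> R;
  deviation : robot -> nat -> R
}.

Definition consecutive (A : nat -> Prop) (t t' : nat) : Prop :=
  A t /\ A t' /\ (t < t')%nat /\
  forall s : nat, (t < s)%nat -> (s < t')%nat -> ~ A s.

(* The cycle of robot [i] from its activation time [t] to its next one [t'].
   [d] is the destination in global coordinates, and [prog u] is the fraction
   of the segment to [d] covered at time [u]. *)
Definition cycle (psi : point -> point) (delta : R) (e : run) (i : robot)
    (t t' : nat) : Prop :=
  let r := traj e i in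
  let Z := local_coords (scaling e i t) (deviation e i t) (r (INR t)) in
  exists (d : point) (prog : R -> R),
    Z d = psi (Z (traj e (negb i) (INR t))) /\
    continuity prog /\
    (forall u v : R, INR t <= u -> u <= v -> v <= INR t' ->
       prog u <= prog v) /\
    prog (INR t) = 0 /\ prog (INR t') <= 1 /\
    (forall u : R, INR t <= u -> u <= INR t' ->
       r u = segment_point (r (INR t)) d (prog u)) /\
    (r (INR t') = d \/ delta <= dist (r (INR t)) (r (INR t'))).

Definition dynamic_compasses (phi : R) (e : run) : Prop :=
  (forall (i : robot) (t : nat),
     - PI < deviation e i t <= PI /\ Rabs (deviation e i t) <= phi) /\
  (forall (i : robot) (t t' s : nat), consecutive (active e i) t t' ->
     (t <= s)%nat -> (s < t')%nat -> deviation e i s = deviation e i t).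

Record async_run (psi : point -> point) (phi delta : R) (e : run) : Prop := {
  async_scaling : forall (i : robot) (t : nat), 0 < scaling e i t;
  async_compasses : dynamic_compasses phi e;
  async_active : forall t : nat, exists i : robot, active e i t;
  async_fair : forall (i : robot) (n : nat),
    exists t : nat, (n <= t)%nat /\ active e i t;
  async_idle : forall (i : robot) (u : R), 0 <= u ->
    (forall t : nat, active e i t -> u <= INR t) -> traj e i u = traj e i 0;
  async_cycle : forall (i : robot) (t t' : nat),
    consecutive (active e i) t t' -> cycle psi delta e i t t'
}.

Definition execution (psi : point -> point) (phi delta : R)
    (C : nat -> configuration) : Prop :=
  exists e : run, async_run psi phi delta e /\
    forall t : nat, C t = (traj e false (INR t), traj e true (INR t)).

Definition gathering_execution (C : nat -> configuration) : Prop :=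
  exists (p : point) (f : nat), forall t : nat, (f <= t)%nat -> C t = (p, p).

Definition gathering_algorithm (phi delta : R) (psi : point -> point) : Prop :=
  forall (C0 : configuration) (C : nat -> configuration),
    execution psi phi delta C -> C 0%nat = C0 -> gathering_execution C.

(* Main.v *)
(** Let L be the lower robot and U the other one, kappa = PI/3 - 2 phi > 0, and
    al in [0, PI) the direction from L to U.  U only ever waits or approaches,
    and it can approach only while al < PI/2 + phi.  When L rotates, it moves
    straight away from the direction al0 - kappa, where al0 is the value of al
    that it observed.  The target q of U is a point through which L has passed,
    so the directions b = (opposite of L's motion), be (from L to q), al, and
    ga (from q to U) satisfy al - kappa <= b <= be <= al <= ga; this order
    survives every interleaving of moves and observations, and al never
    increases.  A complete rotation cycle of length x, begun at distance D,
    lowers al by at least x sin(kappa) / (2 D), while the distance bound E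
    grows by at most x; hence E exp(2 al / sin(kappa)) does not increase, D
    stays bounded, the decrements of al are bounded below, and there are
    finitely many rotations.  After the last one either al <= PI/3, L stays and
    U comes to it, or al >= 2 PI/3, U stays and L comes to it. *)

From Stdlib Require Import Reals Arith Lra Lia Classical ClassicalEpsilon.
Require Import Defs.
Open Scope R_scope.

(** * Polar coordinates and sums of vectors in the plane *)

(** A relation rather than a function, so that radius 0 fits every angle and angles need no
    reduction modulo [2 * PI]. *)
Definition polar (p q : point) (r a : R) : Prop :=
  fst q = fst p + r * cos a /\ snd q = snd p + r * sin a.

Lemma point_eq (p q : point) : fst p = fst q -> snd p = snd q -> p = q.
Proof. destruct p, q; simpl; intros; subst; reflexivity. Qed.

Lemma polar_zero (p q : point) (a : R) : polar p q 0 a <-> q = p.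
Proof.
unfold polar; split.
- intros [H1 H2]; apply point_eq; lra.
- intros ->; split; ring.
Qed.

Lemma polar_proj (o p q : point) (X Y R a c t : R) :
  polar o p X a -> polar p q Y c -> polar o q R t ->
  R * cos t = X * cos a + Y * cos c /\ R * sin t = X * sin a + Y * sin c.
Proof. intros [A1 A2] [B1 B2] [C1 C2]; split; lra. Qed.

Lemma cos_sin_sq (t : R) : cos t * cos t + sin t * sin t = 1.
Proof. pose proof (sin2_cos2 t) as H; unfold Rsqr in H; lra. Qed.

(** Project the triangle [o], [p], [q] on the direction [t] of its side from [o] to [q]. *)
Lemma polar_radius (o p q : point) (X Y R a c t : R) :
  polar o p X a -> polar p q Y c -> polar o q R t ->
  R = X * cos (a - t) + Y * cos (c - t).
Proof.
intros HA HB HC; destruct (polar_proj _ _ _ _ _ _ _ _ _ HA HB HC) as [H1 H2].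
rewrite !cos_minus.
replace R with (R * (cos t * cos t + sin t * sin t)) by (rewrite cos_sin_sq; ring).
replace (R * (cos t * cos t + sin t * sin t))
  with (R * cos t * cos t + R * sin t * sin t) by ring.
rewrite H1, H2; ring.
Qed.

Lemma polar_radius_le (o p q : point) (X Y R a c t : R) :
  0 <= X -> 0 <= Y -> polar o p X a -> polar p q Y c -> polar o q R t ->
  R <= X + Y.
Proof.
intros HX HY HA HB HC; rewrite (polar_radius _ _ _ _ _ _ _ _ _ HA HB HC).
pose proof (COS_bound (a - t)); pose proof (COS_bound (c - t)); nra.
Qed.

Lemma sin_neg_range (x : R) : - PI < x < 0 -> sin x < 0.
Proof.
intros H; replace x with (- (- x)) by ring; rewrite sin_neg.
assert (0 < sin (- x)) by (apply sin_gt_0; lra); lra.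
Qed.

Lemma polar_unique (p q : point) (R R' a a' : R) :
  0 < R -> 0 <= R' -> - PI < a - a' < PI ->
  polar p q R a -> polar p q R' a' -> a = a' /\ R = R'.
Proof.
intros HR HR' Ha [A1 A2] [B1 B2].
assert (E1 : R * cos a = R' * cos a') by lra.
assert (E2 : R * sin a = R' * sin a') by lra.
assert (S : R * sin (a - a') = 0).
{ rewrite sin_minus.
  replace (R * (sin a * cos a' - cos a * sin a'))
    with (R * sin a * cos a' - R * cos a * sin a') by ring.
  rewrite E1, E2; ring. }
assert (Z : sin (a - a') = 0) by nra.
assert (a = a').
{ destruct (Rtotal_order (a - a') 0) as [h|[h|h]]; [|lra|].
  - pose proof (sin_neg_range (a - a')); lra.
  - pose proof (sin_gt_0 (a - a')); lra. }
subst a'; split; [reflexivity|].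
pose proof (cos_sin_sq a).
assert ((R - R') * (cos a * cos a + sin a * sin a)
  = cos a * (R * cos a - R' * cos a) + sin a * (R * sin a - R' * sin a))
  as K by ring.
rewrite H, E1, E2 in K; lra.
Qed.

Lemma polar_exists (p q : point) :
  exists R a, 0 <= R /\ - PI / 2 <= a < 3 * PI / 2 /\ polar p q R a.
Proof.
set (v := (fst q - fst p, snd q - snd p)).
exists (dist origin v), (arg v).
pose proof (arg_spec v) as H; apply (f_equal (fun p => p)) in H.
split; [|split; [apply arg_range|]].
- unfold dist, dist_euc; apply sqrt_pos.
- assert (H1 : fst v = dist origin v * cos (arg v)) by (rewrite H at 1; reflexivity).
  assert (H2 : snd v = dist origin v * sin (arg v)) by (rewrite H at 1; reflexivity).
  split; [rewrite <- H1|rewrite <- H2]; unfold v; simpl; ring.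
Qed.


(** A sum of two vectors stays in the cone that they span. After a rotation by [-a], its direction
    [s] satisfies [R * sin s = Y * sin d >= 0] and [R * sin (d - s) = X * sin d >= 0], which forces
    [0 <= s <= d]. The order of directions under moves rests on this. *)
Lemma polar_sum (o p q : point) (X Y a c : R) :
  0 <= X -> 0 <= Y -> a <= c < a + PI ->
  polar o p X a -> polar p q Y c ->
  exists R t, 0 <= R /\ a <= t <= c /\ polar o q R t.
Proof.
intros HX HY Hac [A1 A2] [B1 B2].
destruct (Req_dec a c) as [<-|Hne].
{ exists (X + Y), a; unfold polar; repeat split; lra. }
set (d := c - a).
set (v := (X + Y * cos d, Y * sin d)).
set (R := dist origin v); set (s := arg v).
assert (HR : 0 <= R) by (unfold R, dist, dist_euc; apply sqrt_pos).
assert (H1 : X + Y * cos d = R * cos s)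
  by exact (f_equal fst (arg_spec v)).
assert (H2 : Y * sin d = R * sin s)
  by exact (f_equal snd (arg_spec v)).
assert (Hs : - PI / 2 <= s < 3 * PI / 2) by apply arg_range.
assert (Hc : R * cos (a + s) = X * cos a + Y * cos c).
{ replace c with (a + d) by (unfold d; ring).
  rewrite !cos_plus.
  replace (R * (cos a * cos s - sin a * sin s))
    with (cos a * (R * cos s) - sin a * (R * sin s)) by ring.
  rewrite <- H1, <- H2; ring. }
assert (Hsn : R * sin (a + s) = X * sin a + Y * sin c).
{ replace c with (a + d) by (unfold d; ring).
  rewrite !sin_plus.
  replace (R * (sin a * cos s + cos a * sin s))
    with (sin a * (R * cos s) + cos a * (R * sin s)) by ring.
  rewrite <- H1, <- H2; ring. }
destruct HR as [HR|HR].
(* A zero sum has no direction of its own; [a] serves as one. *)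
2: { exists 0, a; rewrite <- HR in *; unfold polar; repeat split; lra. }
exists R, (a + s); split; [lra|]; split; [|unfold polar; lra].
assert (Hd : 0 < sin d) by (apply sin_gt_0; unfold d; lra).
assert (0 <= sin s) by nra.
assert (Hpos : 0 <= s <= PI).
{ split; apply Rnot_lt_le; intros h.
  - pose proof (sin_neg_range s); lra.
  - assert (sin (s - PI) = - sin s)
      by (rewrite sin_minus, sin_PI, cos_PI; ring).
    pose proof (sin_gt_0 (s - PI)); lra. }
assert (Hds : R * sin (d - s) = X * sin d).
{ rewrite sin_minus.
  replace (R * (sin d * cos s - cos d * sin s))
    with (sin d * (R * cos s) - cos d * (R * sin s)) by ring.
  rewrite <- H1, <- H2; ring. }
assert (0 <= sin (d - s)) by nra.
assert (s <= d).
{ apply Rnot_lt_le; intros h.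
  pose proof (sin_neg_range (d - s)); unfold d in *; lra. }
unfold d in *; lra.
Qed.

Lemma cos_eq_1_small (x : R) : - 2 * PI < x < 2 * PI -> cos x = 1 -> x = 0.
Proof.
intros Hx Hc.
assert (Hh : sin (x / 2) = 0).
{ pose proof (cos_2a_sin (x / 2)) as E.
  replace (2 * (x / 2)) with x in E by field.
  rewrite Hc in E; nra. }
destruct (Rtotal_order x 0) as [h|[h|h]]; [|lra|].
- pose proof (sin_neg_range (x / 2)); lra.
- pose proof (sin_gt_0 (x / 2)); lra.
Qed.

(** Projecting each of the two representations of [p] on the direction of the other gives
    [m = r * cos] and [r = m * cos] of the same angle, so that cosine is 1. *)
Lemma arg_polar (p : point) (r a : R) :
  0 < r -> - PI / 2 <= a < 3 * PI / 2 -> polar origin p r a -> arg p = a.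
Proof.
intros Hr Ha HP.
set (m := dist origin p).
assert (Hm : 0 <= m) by (unfold m, dist, dist_euc; apply sqrt_pos).
pose proof (arg_range p) as Hs.
assert (HQ : polar origin p m (arg p)).
{ unfold polar; simpl; rewrite !Rplus_0_l; split.
  - exact (f_equal fst (arg_spec p)).
  - exact (f_equal snd (arg_spec p)). }
assert (H0 : polar origin origin 0 a) by (apply polar_zero; reflexivity).
pose proof (polar_radius _ _ _ _ _ _ _ _ _ H0 HP HQ) as E1.
pose proof (polar_radius _ _ _ _ _ _ _ _ _ H0 HQ HP) as E2.
replace (arg p - a) with (- (a - arg p)) in E2 by ring; rewrite cos_neg in E2.
pose proof (COS_bound (a - arg p)).
pose proof PI_RGT_0.
pose proof (cos_eq_1_small (a - arg p)) as K.
assert (m = r) by nra.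
enough (a - arg p = 0) by lra.
apply K; [lra|]; nra.
Qed.

Lemma polar_opp (p q : point) (r a : R) : polar p q r a -> polar q p r (a + PI).
Proof. unfold polar; rewrite neg_cos, neg_sin; intros [-> ->]; split; ring. Qed.

Lemma polar_period (p q : point) (r a : R) :
  polar p q r a <-> polar p q r (a - 2 * PI).
Proof.
unfold polar; rewrite cos_minus, sin_minus, cos_2PI, sin_2PI.
replace (cos a * 1 + sin a * 0) with (cos a) by ring.
replace (sin a * 1 - cos a * 0) with (sin a) by ring; tauto.
Qed.

Lemma polar_dist (p q : point) (r a : R) : 0 <= r -> polar p q r a -> dist p q = r.
Proof.
intros Hr [H1 H2]; unfold dist, dist_euc; rewrite H1, H2.
replace (Rsqr _ + Rsqr _) with (r * r * (cos a * cos a + sin a * sin a))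
  by (unfold Rsqr; ring).
rewrite cos_sin_sq, Rmult_1_r; apply sqrt_square; exact Hr.
Qed.

(** * From local observations to global destinations *)

Lemma local_coords_polar (s a : R) (o p : point) (r b : R) :
  polar o p r b -> polar origin (local_coords s a o p) (s * r) (b - a).
Proof.
intros [H1 H2]; unfold polar, local_coords; simpl; rewrite H1, H2.
rewrite cos_minus, sin_minus; split; ring.
Qed.

Lemma local_coords_inj (s a : R) (o p q : point) :
  0 < s -> local_coords s a o p = local_coords s a o q -> p = q.
Proof.
intros Hs H; injection H as H1 H2.
apply Rmult_eq_reg_l in H1; [|lra]; apply Rmult_eq_reg_l in H2; [|lra].
set (x := fst p - fst q); set (y := snd p - snd q).
assert (K1 : cos a * x + sin a * y = 0) by (unfold x, y; lra).
assert (K2 : cos a * y - sin a * x = 0) by (unfold x, y; lra).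
pose proof (cos_sin_sq a) as K.
assert (x * (cos a * cos a + sin a * sin a)
  = cos a * (cos a * x + sin a * y) - sin a * (cos a * y - sin a * x)) by ring.
assert (y * (cos a * cos a + sin a * sin a)
  = sin a * (cos a * x + sin a * y) + cos a * (cos a * y - sin a * x)) by ring.
rewrite K, K1, K2 in *.
apply point_eq; unfold x, y in *; lra.
Qed.

Lemma local_coords_self (s a : R) (o : point) : local_coords s a o o = origin.
Proof. unfold local_coords, origin; f_equal; ring. Qed.

Lemma rotate_polar (w : R) (p : point) (r a : R) :
  polar origin p r a -> polar origin (rotate w p) r (a + w).
Proof.
unfold polar, rotate; simpl; intros [-> ->]; rewrite cos_plus, sin_plus; split; ring.
Qed.

Lemma polar_functional (o p q : point) (r a : R) :
  polar o p r a -> polar o q r a -> p = q.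
Proof. intros [A1 A2] [B1 B2]; apply point_eq; lra. Qed.

Lemma look_self (phi s a : R) (o d : point) :
  0 < s -> local_coords s a o d = A_AD phi (local_coords s a o o) -> d = o.
Proof.
intros Hs Hd; rewrite local_coords_self in Hd; unfold A_AD in Hd.
destruct excluded_middle_informative as [_|n]; [|now destruct n].
apply (local_coords_inj s a o); [lra|]; rewrite local_coords_self; exact Hd.
Qed.

(** The deviation [a] only decides which branch applies; it cancels from the destination. *)
Lemma look_polar (phi s a : R) (o p d : point) (r b : R) :
  0 < s -> 0 < r -> - PI / 2 <= b - a < 3 * PI / 2 -> polar o p r b ->
  local_coords s a o d = A_AD phi (local_coords s a o p) ->
  d = p /\ 2 * PI / 3 + phi <= b - a \/
  d = o /\ b - a <= PI / 3 - phi \/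
  PI / 3 - phi < b - a < 2 * PI / 3 + phi /\
    polar o d r (b + (2 * PI / 3 + 2 * phi)).
Proof.
intros Hs Hr Hb HP Hd.
pose proof (local_coords_polar s a o p r b HP) as HL.
assert (Hsr : 0 < s * r) by (apply Rmult_lt_0_compat; lra).
pose proof (arg_polar _ _ _ Hsr Hb HL) as HA.
unfold A_AD in Hd; rewrite HA in Hd.
destruct excluded_middle_informative as [e|_].
{ exfalso; rewrite e in HL; apply polar_dist in HL; [|lra].
  unfold dist, dist_euc, origin in HL; simpl in HL.
  replace (Rsqr _ + Rsqr _) with 0 in HL by (unfold Rsqr; ring).
  rewrite sqrt_0 in HL; lra. }
destruct excluded_middle_informative as [h|h].
{ left; split; [|lra]; apply (local_coords_inj s a o); auto. }
destruct excluded_middle_informative as [h'|h'].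
{ right; left; split; [|lra].
  apply (local_coords_inj s a o); [lra|]; rewrite local_coords_self; exact Hd. }
right; right; split; [lra|].
set (c := b + (2 * PI / 3 + 2 * phi)).
set (e := (fst o + r * cos c, snd o + r * sin c) : point).
assert (He : polar o e r c) by (split; reflexivity).
assert (d = e) as ->; [|exact He].
apply (local_coords_inj s a o); [lra|]; rewrite Hd.
apply (polar_functional origin _ _ (s * r) (c - a)).
- replace (c - a) with (b - a + (2 * PI / 3 + 2 * phi)) by (unfold c; ring).
  apply rotate_polar; exact HL.
- apply local_coords_polar; exact He.
Qed.

(** The deviation shifts each threshold by at most [phi]. A rotation aims at direction
    [al + 2 * PI / 3 + 2 * phi]; its opposite, from the destination back to [l], is the one
    recorded. *)
Lemma lower_look (phi s a : R) (l u d : point) (D al : R) :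
  0 <= phi < PI / 6 -> 0 < s -> Rabs a <= phi ->
  0 <= D -> 0 <= al < PI -> polar l u D al ->
  local_coords s a l d = A_AD phi (local_coords s a l u) ->
  d = l /\ (D = 0 \/ al <= PI / 3) \/
  d = u /\ 2 * PI / 3 <= al \/
  0 < D /\ PI / 3 - 2 * phi < al /\ polar d l D (al - (PI / 3 - 2 * phi)).
Proof.
intros Hphi Hs Ha HD Hal HP Hd.
assert (- phi <= a <= phi) by (unfold Rabs in Ha; destruct Rcase_abs; lra).
destruct HD as [HD|<-].
2: { apply polar_zero in HP; subst u; left; split; [|lra].
     exact (look_self _ _ _ _ _ Hs Hd). }
destruct (look_polar phi s a l u d D al) as [[-> h]|[[-> h]|[h He]]]; auto; try lra.
- right; left; split; [reflexivity|lra].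
- left; split; [reflexivity|lra].
- right; right; split; [lra|]; split; [lra|].
  apply polar_opp, polar_period in He.
  replace (al - (PI / 3 - 2 * phi))
    with (al + (2 * PI / 3 + 2 * phi) + PI - 2 * PI) by field; exact He.
Qed.

(** Here [phi < PI / 6] excludes a rotation: the local direction of L is either at least
    [PI - phi > 2 * PI / 3 + phi], or, lowered by one turn, below [phi < PI / 3 - phi]. *)
Lemma upper_look (phi s a : R) (l u d : point) (D al : R) :
  0 <= phi < PI / 6 -> 0 < s -> Rabs a <= phi ->
  0 <= D -> 0 <= al < PI -> polar l u D al ->
  local_coords s a u d = A_AD phi (local_coords s a u l) ->
  d = l /\ al < PI / 2 + phi \/
  d = u /\ (D = 0 \/ PI / 2 - phi <= al).
Proof.
intros Hphi Hs Ha HD Hal HP Hd.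
assert (- phi <= a <= phi) by (unfold Rabs in Ha; destruct Rcase_abs; lra).
destruct HD as [HD|<-].
2: { apply polar_zero in HP; subst u; right; split; [|lra].
     exact (look_self _ _ _ _ _ Hs Hd). }
apply polar_opp in HP.
destruct (Rlt_le_dec (al + PI - a) (3 * PI / 2)) as [h|h].
- destruct (look_polar phi s a u l d D (al + PI)) as [[-> k]|[[-> k]|[k _]]];
    auto; try lra.
  left; split; [reflexivity|lra].
- apply polar_period in HP.
  destruct (look_polar phi s a u l d D (al + PI - 2 * PI))
    as [[-> k]|[[-> k]|[k _]]]; auto; try lra.
  right; split; [reflexivity|lra].
Qed.

(** * The order of directions under single moves and looks *)

(* [l], [u]: positions of L and U; [q]: target of U, with [q = u] when U waits.
   A zero distance leaves its angle free, so that coincident points need no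
   separate case. *)
Definition pose (phi b al E : R) (l q u : point) : Prop :=
  exists V be G ga D : R,
    (polar l q V be /\ polar q u G ga /\ polar l u D al) /\
    (0 <= V /\ 0 <= G /\ 0 <= D /\ V + G <= E) /\
    (0 <= b /\ b <= be <= al /\ al <= ga < PI) /\
    al <= b + (PI / 3 - 2 * phi) /\ (G = 0 \/ ga < PI / 2 + phi).

(** The signed distance of [q] from the line through [p] in direction [b]; sliding [p] along that
    line does not change it. *)
Definition cross (b : R) (p q : point) : R :=
  cos b * (snd q - snd p) - sin b * (fst q - fst p).

Lemma cross_polar (b : R) (p q : point) (r a : R) :
  polar p q r a -> cross b p q = r * sin (a - b).
Proof. intros [H1 H2]; unfold cross; rewrite H1, H2, sin_minus; ring. Qed.

(* With [H = D sin kappa] and [K = D cos kappa + x], the second condition bounds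
   the cotangent of [al - b] below by [cot kappa + x / (D sin kappa)]: after
   travelling [x], L sees U at least as low as if U had not moved. *)
Definition swept (b H K al : R) (l u : point) : Prop :=
  cross b l u <= H /\ K * sin (al - b) <= H * cos (al - b).

(** The vector from [l] to the new position is [k] times the one to [q] plus [1 - k] times the one
    to [u], so its direction lies between [be] and [al]. The height over [b] does not grow because
    [cross b q u >= 0]. *)
Lemma pose_move_upper (phi b al E : R) (l q u : point) (k : R) :
  0 <= phi -> 0 <= k <= 1 -> pose phi b al E l q u ->
  exists al', al' <= al /\ pose phi b al' E l q (segment_point u q k) /\
    forall H K, 0 <= H -> 0 <= K -> swept b H K al l u ->
      swept b H K al' l (segment_point u q k).
Proof.
intros Hphi Hk (V & be & G & ga & D & (PV & PG & PD) & (HV & HG & HD & HE) &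
  (Hb & Hbe & Hga) & Hal & Hg).
set (u' := segment_point u q k).
set (m := segment_point l q k).
assert (P1 : polar l m (k * V) be)
  by (destruct PV as [A1 A2]; split; simpl; rewrite ?A1, ?A2; ring).
assert (P2 : polar m u' ((1 - k) * D) al).
{ destruct PD as [A1 A2]; split; simpl; rewrite ?A1, ?A2; ring. }
assert (P3 : polar q u' ((1 - k) * G) ga)
  by (destruct PG as [A1 A2]; split; simpl; rewrite ?A1, ?A2; ring).
assert (HkG : 0 <= k * G) by (apply Rmult_le_pos; lra).
assert (Hk'G : 0 <= (1 - k) * G) by (apply Rmult_le_pos; lra).
assert (HkV : 0 <= k * V) by (apply Rmult_le_pos; lra).
assert (HkD : 0 <= (1 - k) * D) by (apply Rmult_le_pos; lra).
destruct (polar_sum l m u' (k * V) ((1 - k) * D) be al)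
  as (D' & al' & HD' & Hal' & PD'); auto; try lra.
exists al'; split; [lra|]; split.
- exists V, be, ((1 - k) * G), ga, D'; repeat split; try lra; try apply PV;
    try apply P3; try apply PD'.
- intros H K HH HK [S1 S2]; split.
  + apply Rle_trans with (2 := S1).
    assert (cross b l u' = cross b l u - k * cross b q u)
      as -> by (unfold cross, u', segment_point; simpl; ring).
    rewrite (cross_polar b q u G ga PG).
    assert (0 <= sin (ga - b)) by (apply sin_ge_0; lra).
    assert (0 <= k * G * sin (ga - b)) by (apply Rmult_le_pos; lra).
    lra.
  + assert (sin (al' - b) <= sin (al - b)) by (apply sin_incr_1; lra).
    assert (cos (al - b) <= cos (al' - b)) by (apply cos_decr_1; lra).
    nra.
Qed.

(** As L moves opposite to [b], its directions to [q] and [u] can only turn toward [b]. The order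
    [be' <= al' <= ga] comes from reaching [u] from [l'] along two paths, through [l] and through
    [q]. *)
Lemma pose_move_lower (phi b al E : R) (l l' q u : point) (y : R) :
  0 <= phi -> 0 <= y -> polar l' l y b -> pose phi b al E l q u ->
  exists al', al' <= al /\ pose phi b al' (E + y) l' q u /\
    forall H K, swept b H K al l u -> swept b H (K + y) al' l' u.
Proof.
intros Hphi Hy Py Hpose.
destruct Hy as [Hy|<-].
(* With [y = 0] the new distance could vanish, and the two paths to [u] would not determine the same
   angle. *)
2: { apply polar_zero in Py; subst l'; exists al.
     rewrite Rplus_0_r; split; [lra|]; split; [exact Hpose|].
     intros H K; rewrite Rplus_0_r; auto. }
destruct Hpose as (V & be & G & ga & D & (PV & PG & PD) & (HV & HG & HD & HE) &
  (Hb & Hbe & Hga) & Hal & Hg).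
destruct (polar_sum l' l q y V b be) as (V' & be' & HV' & Hbe' & PV');
  auto; try lra.
destruct (polar_sum l' l u y D b al) as (D' & al' & HD' & Hal' & PD');
  auto; try lra.
destruct (polar_sum l' q u V' G be' ga) as (D2 & al2 & HD2 & Hal2 & PD2);
  auto; try lra.
assert (0 < cos (al - b)) by (apply cos_gt_0; lra).
assert (C1 : D' * cos (al' - b) = D * cos (al - b) + y).
{ destruct (polar_proj _ _ _ _ _ _ _ _ _ Py PD PD') as [E1 E2].
  rewrite !cos_minus.
  replace (D' * (cos al' * cos b + sin al' * sin b))
    with (D' * cos al' * cos b + D' * sin al' * sin b) by ring.
  rewrite E1, E2.
  pose proof (cos_sin_sq b) as Q.
  replace y with (y * (cos b * cos b + sin b * sin b)) at 3
    by (rewrite Q; ring).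
  ring. }
assert (C2 : cross b l' u = cross b l u).
{ destruct Py as [E1 E2]; unfold cross; rewrite E1, E2; ring. }
assert (0 < D').
{ destruct HD' as [h|<-]; [exact h|exfalso].
  assert (0 <= D * cos (al - b)) by (apply Rmult_le_pos; lra); lra. }
destruct (polar_unique l' u D' D2 al' al2) as [<- _]; auto; try lra.
pose proof (polar_radius_le _ _ _ _ _ _ _ _ _ (Rlt_le _ _ Hy) HV Py PV PV').
exists al'; split; [lra|]; split.
- exists V', be', G, ga, D'; repeat split; try lra; try apply PV';
    try apply PG; try apply PD'.
- intros h K [S1 S2]; split; [lra|].
  rewrite (cross_polar b l u D al PD) in S1, C2.
  rewrite (cross_polar b l' u D' al' PD') in C2.
  (* Multiplied by [D'], the goal bounds [(K + y) * (D * sin (al - b))] by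
     [h * (D * cos (al - b) + y)]: it is [D] times the old inequality plus [y] times the height
     bound. *)
  assert (y * (D * sin (al - b)) <= y * h) by (apply Rmult_le_compat_l; lra).
  assert (D * (K * sin (al - b)) <= D * (h * cos (al - b)))
    by (apply Rmult_le_compat_l; lra).
  apply (Rmult_le_reg_l D'); [lra|].
  replace (D' * ((K + y) * sin (al' - b)))
    with ((K + y) * (D' * sin (al' - b))) by ring.
  replace (D' * (h * cos (al' - b))) with (h * (D' * cos (al' - b))) by ring.
  rewrite C1, C2; lra.
Qed.

(** The path through the old target collapses to the straight segment from [l] to [u], no longer
    than [V + G] by the triangle inequality, so [E] remains a bound. *)
Lemma pose_observe_upper (phi b al E : R) (l q q' u : point) :
  0 <= phi < PI / 6 -> pose phi b al E l q u ->
  q' = l /\ al < PI / 2 + phi \/ q' = u -> pose phi b al E l q' u.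
Proof.
intros Hphi (V & be & G & ga & D & (PV & PG & PD) & (HV & HG & HD & HE) &
  (Hb & Hbe & Hga) & Hal & Hg) Hq.
pose proof (polar_radius_le _ _ _ _ _ _ _ _ _ HV HG PV PG PD).
destruct Hq as [[-> Hq]| ->].
- exists 0, al, D, al, D; repeat split; try lra; try apply PD.
- exists D, al, 0, al, D; repeat split; try lra; try apply PD.
Qed.

Lemma pose_direction (phi b al E : R) (l q u : point) :
  pose phi b al E l q u ->
  exists D, 0 <= D <= E /\ 0 <= al < PI /\ polar l u D al.
Proof.
intros (V & be & G & ga & D & (PV & PG & PD) & (HV & HG & HD & HE) &
  (Hb & Hbe & Hga) & Hal & Hg).
pose proof (polar_radius_le _ _ _ _ _ _ _ _ _ HV HG PV PG PD).
exists D; repeat split; try lra; apply PD.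
Qed.

(** Serves to start a new rotation: its backward direction is [al] minus the opening, which is at
    most the old [b] since [al <= b + (PI / 3 - 2 * phi)]. *)
Lemma pose_rebase (phi b b' al E E' : R) (l q u : point) :
  0 <= b' <= b -> al <= b' + (PI / 3 - 2 * phi) -> E <= E' ->
  pose phi b al E l q u -> pose phi b' al E' l q u.
Proof.
intros Hb' Hal' HE' (V & be & G & ga & D & (PV & PG & PD) & (HV & HG & HD & HE) &
  (Hb & Hbe & Hga) & Hal & Hg).
exists V, be, G, ga, D; repeat split; try lra; try apply PV; try apply PG; apply PD.
Qed.

(** * Runs sampled at natural times *)

(* [r n] is the position at time [n], [T n] the destination of the cycle in
   progress just after a possible activation at time [n]. *)
Record moves (delta : R) (r T : nat -> point) (A : nat -> Prop) : Prop := {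
  moves_step : forall n, exists k, 0 <= k <= 1 /\
    r (S n) = segment_point (r n) (T n) k;
  moves_keep : forall n, ~ A (S n) -> T (S n) = T n;
  moves_idle : ~ A 0%nat -> T 0%nat = r 0%nat;
  moves_fair : forall n, exists m, (n <= m)%nat /\ A m;
  moves_cycle : forall t t', consecutive A t t' ->
    r t' = T t \/ delta <= dist (r t) (r t')
}.

Lemma next_activation (A : nat -> Prop) (n : nat) :
  (forall n, exists m, (n <= m)%nat /\ A m) ->
  exists t, (n < t)%nat /\ A t /\ forall s, (n < s)%nat -> (s < t)%nat -> ~ A s.
Proof.
intros HA; destruct (HA (S n)) as [m [Hm Am]].
revert Hm Am; induction m as [m IH] using lt_wf_ind; intros Hm Am.
destruct (classic (exists s, (n < s)%nat /\ (s < m)%nat /\ A s))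
  as [(s & H1 & H2 & H3)|Hno].
- apply (IH s); auto.
- exists m; split; [lia|]; split; [exact Am|].
  intros s H1 H2 H3; apply Hno; eauto.
Qed.

Lemma consecutive_unique (A : nat -> Prop) (t t1 t2 : nat) :
  consecutive A t t1 -> consecutive A t t2 -> t1 = t2.
Proof.
intros (_ & H1 & L1 & N1) (_ & H2 & L2 & N2).
destruct (Nat.lt_total t1 t2) as [h|[h|h]]; [|exact h|].
- now destruct (N2 t1 L1 h).
- now destruct (N1 t2 L2 h).
Qed.

(** Looks occur only at natural times, so the sampled positions suffice. Monotone progress along a
    segment becomes, at each time unit, a step covering some fraction of what remains. *)
Lemma run_moves (psi : point -> point) (phi delta : R) (e : run) (i : robot) :
  async_run psi phi delta e ->
  exists T, moves delta (fun n => traj e i (INR n)) T (active e i) /\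
    forall t, active e i t ->
      let Z := local_coords (scaling e i t) (deviation e i t) (traj e i (INR t)) in
      Z (T t) = psi (Z (traj e (negb i) (INR t))).
Proof.
intros He.
set (A := active e i); set (r := fun n => traj e i (INR n)).
pose proof (fun n => async_fair _ _ _ _ He i n) as HF; fold A in HF.
(* The premise [A t] makes a destination exist at every [t], inactive ones included, so that a
   single choice function can be taken. *)
set (P := fun (t : nat) (d : point) => A t ->
  (let Z := local_coords (scaling e i t) (deviation e i t) (r t) in
   Z d = psi (Z (traj e (negb i) (INR t)))) /\
  forall t', consecutive A t t' ->
    (exists prog : nat -> R, (forall n, (t <= n)%nat -> (n <= t')%nat ->
       r n = segment_point (r t) d (prog n)) /\
       (forall n, (t <= n)%nat -> (n < t')%nat -> prog n <= prog (S n) <= 1)) /\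
    (r t' = d \/ delta <= dist (r t) (r t'))).
assert (HP : forall t, exists d, P t d).
{ intros t; destruct (classic (A t)) as [At|nAt]; [|exists origin; intros h; tauto].
  destruct (next_activation A t HF) as (t' & H1 & H2 & H3).
  assert (Hc : consecutive A t t') by (repeat split; auto).
  destruct (async_cycle _ _ _ _ He i t t' Hc)
    as (d & prog & Q1 & _ & Q2 & Q3 & Q4 & Q5 & Q6).
  exists d; intros _; split; [exact Q1|].
  intros t2 Hc2; rewrite <- (consecutive_unique _ _ _ _ Hc Hc2); split; [|exact Q6].
  exists (fun n => prog (INR n)); split.
  - intros n L1 L2; apply Q5; apply le_INR; lia.
  - intros n L1 L2; split.
    + apply Q2; apply le_INR; lia.
    + apply Rle_trans with (2 := Q4); apply Q2; try apply le_INR; try lia. }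
set (dst := fun t => proj1_sig (constructive_indefinite_description _ (HP t))).
assert (Hdst : forall t, P t (dst t))
  by (intros t; exact (proj2_sig (constructive_indefinite_description _ (HP t)))).
set (T := fix T (n : nat) : point :=
  if excluded_middle_informative (A n) then dst n
  else match n with O => r 0%nat | S m => T m end).
assert (TA : forall n, A n -> T n = dst n).
{ intros [|n] h; simpl; destruct excluded_middle_informative; tauto. }
assert (TN : forall n, ~ A (S n) -> T (S n) = T n).
{ intros n h; simpl; destruct excluded_middle_informative; tauto. }
assert (T0 : ~ A 0%nat -> T 0%nat = r 0%nat).
{ intros h; simpl; destruct excluded_middle_informative; tauto. }
(* Either nothing has been activated up to [n], or [s] is the last activation and its destination is
   still current. *)
assert (HT : forall n, ((forall s, (s <= n)%nat -> ~ A s) /\ T n = r 0%nat) \/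
  exists s, (s <= n)%nat /\ A s /\
    (forall m, (s < m)%nat -> (m <= n)%nat -> ~ A m) /\ T n = dst s).
{ induction n as [|n IH].
  - destruct (classic (A 0%nat)) as [h|h].
    + right; exists 0%nat; repeat split; auto; intros; lia.
    + left; split; auto; intros s hs; replace s with 0%nat by lia; exact h.
  - destruct (classic (A (S n))) as [h|h].
    { right; exists (S n); repeat split; auto; intros; lia. }
    rewrite (TN n h); destruct IH as [[H1 H2]|(s & H1 & H2 & H3 & H4)].
    + left; split; auto; intros s hs.
      destruct (Nat.eq_dec s (S n)) as [->|]; [exact h|apply H1; lia].
    + right; exists s; repeat split; auto; intros m L1 L2.
      destruct (Nat.eq_dec m (S n)) as [->|]; [exact h|apply H3; lia]. }
exists T; split; [constructor|]; auto.
- intros n; destruct (HT n) as [[H1 H2]|(s & H1 & H2 & H3 & H4)].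
  + exists 0; split; [lra|].
    assert (Hr : forall m, (m <= S n)%nat -> r m = r 0%nat).
    { intros m hm; unfold r; simpl INR.
      apply (async_idle _ _ _ _ He); [apply pos_INR|].
      intros t At; apply le_INR.
      destruct (Nat.le_gt_cases m t) as [h|h]; [exact h|].
      exfalso; apply (H1 t); [lia|exact At]. }
    fold (r n) (r (S n)); rewrite (Hr n), (Hr (S n)) by lia.
    apply point_eq; simpl; ring.
  + destruct (next_activation A n HF) as (t' & L1 & At' & N1).
    assert (Hc : consecutive A s t').
    { repeat split; auto; [lia|]; intros m L2 L3.
      destruct (Nat.le_gt_cases m n); [apply H3|apply N1]; auto. }
    destruct (Hdst s H2) as [_ Hs]; destruct (Hs t' Hc) as [(prog & R1 & R2) _].
    fold (r n) (r (S n)); rewrite H4.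
    rewrite (R1 n), (R1 (S n)) by lia.
    destruct (R2 n) as [R3 R4]; try lia.
    (* At [prog n = 1] nothing remains of the segment and the quotient below would divide by
       zero. *)
    destruct (Req_dec (prog n) 1) as [h|h].
    * exists 0; split; [lra|]; rewrite h.
      replace (prog (S n)) with 1 by lra; apply point_eq; simpl; ring.
    * exists ((prog (S n) - prog n) / (1 - prog n)); split.
      { split.
        - apply Rmult_le_pos; [lra|]; apply Rlt_le, Rinv_0_lt_compat; lra.
        - apply (Rmult_le_reg_r (1 - prog n)); [lra|].
          unfold Rdiv; rewrite Rmult_assoc, Rinv_l; lra. }
      apply point_eq; simpl; field; lra.
- intros t t' Hc; destruct (Hdst t (proj1 Hc)) as [_ Hs].
  rewrite (TA t (proj1 Hc)); exact (proj2 (Hs t' Hc)).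
- intros t At; rewrite (TA t At); exact (proj1 (Hdst t At)).
Qed.

(** * Motion toward a constant target *)

Lemma segment_point_trans (p c : point) (x k : R) :
  segment_point (segment_point p c x) c k = segment_point p c (x + k * (1 - x)).
Proof. apply point_eq; simpl; ring. Qed.

Lemma segment_point_dist (p c : point) (x : R) :
  0 <= x <= 1 ->
  dist p (segment_point p c x) = x * dist p c /\
  dist (segment_point p c x) c = (1 - x) * dist p c.
Proof.
intros Hx; destruct (polar_exists p c) as (d & a & Hd & _ & HP).
rewrite (polar_dist p c d a Hd HP).
destruct HP as [H1 H2].
split; apply (polar_dist _ _ _ a); try (apply Rmult_le_pos; lra);
  split; simpl; rewrite ?H1, ?H2; ring.
Qed.

Lemma convex_bounds (x k : R) :
  0 <= x <= 1 -> 0 <= k <= 1 -> x <= x + k * (1 - x) <= 1.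
Proof. intros Hx Hk; nra. Qed.

(** Each cycle ends at [c] or shortens the distance to [c] by at least [delta]; the induction counts
    how many times [delta] exceeds the remaining distance. *)
Lemma homing (delta : R) (r T : nat -> point) (A : nat -> Prop) (c : point) (n : nat) :
  0 < delta -> moves delta r T A -> (forall m, (n <= m)%nat -> T m = c) ->
  exists f, forall m, (f <= m)%nat -> r m = c.
Proof.
intros Hdelta HM HT.
assert (Hseg : forall t m, (n <= t)%nat -> exists x, 0 <= x <= 1 /\
  r (t + m)%nat = segment_point (r t) c x).
{ intros t m Ht; induction m as [|m (x & Hx & IH)].
  - exists 0; split; [lra|]; rewrite Nat.add_0_r; apply point_eq; simpl; ring.
  - destruct (moves_step _ _ _ _ HM (t + m)) as (k & Hk & E).
    exists (x + k * (1 - x)).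
    pose proof (convex_bounds x k Hx Hk); split; [lra|].
    rewrite Nat.add_succ_r, E, IH, HT by lia; apply segment_point_trans. }
assert (Hind : forall (j t : nat), (n <= t)%nat -> A t ->
  dist (r t) c < INR j * delta -> exists f, forall m, (f <= m)%nat -> r m = c).
{ induction j as [|j IH]; intros t Ht At Hd.
  - simpl in Hd; unfold dist, dist_euc in Hd.
    pose proof (sqrt_pos (Rsqr (fst (r t) - fst c) + Rsqr (snd (r t) - snd c))); lra.
  - destruct (next_activation A t (moves_fair _ _ _ _ HM)) as (t' & L & At' & N).
    destruct (moves_cycle _ _ _ _ HM t t') as [E|E]; [repeat split; auto| |].
    + exists t'; intros m Hm; rewrite HT in E by lia.
      destruct (Hseg t' (m - t')%nat) as (x & _ & Ex); [lia|].
      replace (t' + (m - t'))%nat with m in Ex by lia.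
      rewrite Ex, E; apply point_eq; simpl; ring.
    + apply (IH t'); [lia|exact At'|].
      destruct (Hseg t (t' - t)%nat) as (x & Hx & Ex); [lia|].
      replace (t + (t' - t))%nat with t' in Ex by lia.
      destruct (segment_point_dist (r t) c x Hx) as [D1 D2].
      rewrite <- Ex in D1, D2.
      rewrite S_INR in Hd; lra. }
destruct (moves_fair _ _ _ _ HM n) as (t & Ht & At).
destruct (INR_unbounded (dist (r t) c / delta)) as [j Hj].
apply (Hind j t Ht At).
apply (Rmult_lt_compat_r delta) in Hj; [|lra].
unfold Rdiv in Hj; rewrite Rmult_assoc, Rinv_l, Rmult_1_r in Hj; lra.
Qed.

(** * The joint evolution of the two robots and the rotation cycle *)

(** The angle kappa from the backward direction of a rotating L up to the direction in which it saw
    U. *)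
Definition opening (phi : R) : R := PI / 3 - 2 * phi.

(** Scalings and deviations are eliminated: of each look only the consequences valid for every
    admissible deviation remain. *)
Record system (phi delta : R) (l u tl tu : nat -> point) (AL AU : nat -> Prop) :
  Prop := {
  lower_moves : moves delta l tl AL;
  upper_moves : moves delta u tu AU;
  lower_looks : forall n D al, AL n ->
    0 <= D -> 0 <= al < PI -> polar (l n) (u n) D al ->
    tl n = l n /\ (D = 0 \/ al <= PI / 3) \/
    tl n = u n /\ 2 * PI / 3 <= al \/
    0 < D /\ opening phi < al /\ polar (tl n) (l n) D (al - opening phi);
  upper_looks : forall n D al, AU n ->
    0 <= D -> 0 <= al < PI -> polar (l n) (u n) D al ->
    tu n = l n /\ al < PI / 2 + phi \/
    tu n = u n /\ (D = 0 \/ PI / 2 - phi <= al)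
}.

Definition meet (l u : nat -> point) : Prop :=
  exists p f, forall m : nat, (f <= m)%nat -> l m = p /\ u m = p.

Definition rotating (phi : R) (l u tl tu : nat -> point) (AL : nat -> Prop)
    (n : nat) (al E : R) : Prop :=
  AL n /\ opening phi < al /\
  pose phi (al - opening phi) al E (l n) (tu n) (u n) /\
  exists D, 0 < D /\ polar (l n) (u n) D al /\
    polar (tl n) (l n) D (al - opening phi).

Lemma system_observe phi delta l u tl tu AL AU n b al E :
  0 <= phi < PI / 6 -> system phi delta l u tl tu AL AU ->
  pose phi b al E (l (S n)) (tu n) (u (S n)) ->
  pose phi b al E (l (S n)) (tu (S n)) (u (S n)).
Proof.
intros Hphi HS HP; destruct (classic (AU (S n))) as [h|h].
- destruct (pose_direction _ _ _ _ _ _ _ HP) as (D & HD & Hal & PD).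
  apply (pose_observe_upper _ _ _ _ _ (tu n)); auto.
  destruct (upper_looks _ _ _ _ _ _ _ _ HS (S n) D al) as [H|[H _]]; tauto.
- rewrite (moves_keep _ _ _ _ (upper_moves _ _ _ _ _ _ _ _ HS) n h); exact HP.
Qed.

(** Destinations are fixed between natural times, so simultaneous moves can be replayed one after
    the other: first L, then U, then the possible look of U. *)
Lemma system_step phi delta l u tl tu AL AU n b al E y :
  0 <= phi < PI / 6 -> system phi delta l u tl tu AL AU ->
  pose phi b al E (l n) (tu n) (u n) -> 0 <= y -> polar (l (S n)) (l n) y b ->
  exists al', al' <= al /\ pose phi b al' (E + y) (l (S n)) (tu (S n)) (u (S n)) /\
    forall H K, 0 <= H -> 0 <= K -> swept b H K al (l n) (u n) ->
      swept b H (K + y) al' (l (S n)) (u (S n)).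
Proof.
intros Hphi HS HP Hy Py.
destruct (pose_move_lower phi b al E (l n) (l (S n)) (tu n) (u n) y)
  as (a1 & Ha1 & P1 & S1); auto; try lra.
destruct (moves_step _ _ _ _ (upper_moves _ _ _ _ _ _ _ _ HS) n) as (k & Hk & Ek).
destruct (pose_move_upper phi b a1 (E + y) (l (S n)) (tu n) (u n) k)
  as (a2 & Ha2 & P2 & S2); auto; try lra.
rewrite <- Ek in P2, S2.
exists a2; split; [lra|]; split; [eapply system_observe; eauto|].
intros H K HH HK HSw; apply S2; auto; lra.
Qed.

Lemma system_step_still phi delta l u tl tu AL AU n b al E :
  0 <= phi < PI / 6 -> system phi delta l u tl tu AL AU ->
  pose phi b al E (l n) (tu n) (u n) -> tl n = l n ->
  l (S n) = l n /\
  exists al', al' <= al /\ pose phi b al' E (l (S n)) (tu (S n)) (u (S n)).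
Proof.
intros Hphi HS HP Ht.
destruct (moves_step _ _ _ _ (lower_moves _ _ _ _ _ _ _ _ HS) n) as (k & Hk & Ek).
rewrite Ht in Ek.
assert (El : l (S n) = l n) by (rewrite Ek; apply point_eq; simpl; ring).
split; [exact El|].
destruct (system_step phi delta l u tl tu AL AU n b al E 0) as (a & Ha & Pa & _);
  auto; try lra.
- apply polar_zero; symmetry; exact El.
- exists a; rewrite Rplus_0_r in Pa; auto.
Qed.

Lemma sin_opening_pos (phi : R) : 0 <= phi < PI / 6 -> 0 < sin (opening phi).
Proof. intros H; apply sin_gt_0; unfold opening; lra. Qed.

Lemma swept_angle (k d D x : R) :
  0 < k <= PI / 3 -> 0 <= d <= k -> 0 < D -> 0 <= x <= D ->
  (D * cos k + x) * sin (k - d) <= D * sin k * cos (k - d) ->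
  x * sin k <= 2 * D * d.
Proof.
intros Hk Hd HD Hx H.
assert (E : sin d = sin k * cos (k - d) - cos k * sin (k - d)).
{ rewrite <- sin_minus; f_equal; ring. }
assert (H1 : x * sin (k - d) <= D * sin d) by (rewrite E; lra).
assert (H2 : sin d <= d).
{ destruct (Req_dec d 0) as [->|]; [rewrite sin_0; lra|].
  apply Rlt_le, sin_lt_x; lra. }
assert (H3 : sin k = sin (k - d) * cos d + cos (k - d) * sin d).
{ rewrite <- sin_plus; f_equal; ring. }
assert (0 <= sin (k - d)) by (apply sin_ge_0; lra).
assert (0 <= sin d) by (apply sin_ge_0; lra).
pose proof (COS_bound d); pose proof (COS_bound (k - d)).
assert (HK : sin k <= sin (k - d) + d) by nra.
assert (x * sin k <= x * (sin (k - d) + d)) by (apply Rmult_le_compat_l; lra).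
assert (D * sin d <= D * d) by (apply Rmult_le_compat_l; lra).
assert (x * d <= D * d) by (apply Rmult_le_compat_r; lra).
lra.
Qed.

Lemma system_rotation phi delta l u tl tu AL AU n al E :
  0 <= phi < PI / 6 -> system phi delta l u tl tu AL AU ->
  rotating phi l u tl tu AL n al E ->
  exists n' al' x D, AL n' /\ 0 < D <= E /\ 0 <= x <= D /\ (x = D \/ delta <= x) /\
    pose phi (al - opening phi) al' (E + x) (l n') (tu n') (u n') /\ al' <= al /\
    x * sin (opening phi) <= 2 * D * (al - al').
Proof.
intros Hphi HS (An & Hal & HP & D & HD & PD & PT).
set (b := al - opening phi) in *.
destruct (next_activation AL n
  (moves_fair _ _ _ _ (lower_moves _ _ _ _ _ _ _ _ HS))) as (n' & Ln & An' & Nn).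
pose proof (sin_opening_pos phi Hphi) as Hsin.
assert (Hcos : 0 < cos (opening phi)) by (apply cos_gt_0; unfold opening; lra).
(* The invariant is carried up to time [n'] itself, but [tl] is constant only before it, where L
   chooses anew; hence [j < m]. At [m = 0] both conditions of [swept] are equalities. *)
assert (Hm : forall m, (n + m <= n')%nat ->
  (forall j, (j < m)%nat -> tl (n + j)%nat = tl n) /\
  exists x a, 0 <= x <= D /\ a <= al /\ polar (l (n + m)%nat) (l n) x b /\
    pose phi b a (E + x) (l (n + m)%nat) (tu (n + m)%nat) (u (n + m)%nat) /\
    swept b (D * sin (opening phi)) (D * cos (opening phi) + x) a
      (l (n + m)%nat) (u (n + m)%nat)).
{ induction m as [|m IH]; intros Lm.
  - split; [intros; lia|]; exists 0, al; rewrite !Nat.add_0_r, !Rplus_0_r.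
    split; [lra|]; split; [lra|]; split; [apply polar_zero; reflexivity|].
    split; [exact HP|]; split.
    + rewrite (cross_polar b _ _ _ _ PD).
      replace (al - b) with (opening phi) by (unfold b; ring); lra.
    + replace (al - b) with (opening phi) by (unfold b; ring); lra.
  - destruct IH as (IHt & x & a & Hx & Ha & Px & Pp & Ps); [lia|].
    assert (Et : tl (n + m)%nat = tl n).
    { destruct m as [|m]; [f_equal; lia|].
      rewrite <- (IHt m) by lia; rewrite Nat.add_succ_r.
      apply (moves_keep _ _ _ _ (lower_moves _ _ _ _ _ _ _ _ HS)); apply Nn; lia. }
    split.
    { intros j Lj; destruct (Nat.eq_dec j m) as [->|]; [exact Et|apply IHt; lia]. }
    destruct (moves_step _ _ _ _ (lower_moves _ _ _ _ _ _ _ _ HS) (n + m))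
      as (k & Hk & Ek).
    rewrite Et in Ek.
    assert (Hy : 0 <= k * (D - x)) by (apply Rmult_le_pos; lra).
    assert (k * (D - x) <= 1 * (D - x)) by (apply Rmult_le_compat_r; lra).
    assert (Py : polar (l (S (n + m))) (l (n + m)%nat) (k * (D - x)) b).
    { rewrite Ek; destruct Px as [X1 X2], PT as [T1 T2]; split; simpl;
        [replace (fst (l (n + m)%nat)) with (fst (tl n) + (D - x) * cos b) by lra
        |replace (snd (l (n + m)%nat)) with (snd (tl n) + (D - x) * sin b) by lra];
        ring. }
    destruct (system_step phi delta l u tl tu AL AU (n + m) b a (E + x) (k * (D - x)))
      as (a' & Ha' & Pp' & Ps'); auto.
    exists (x + k * (D - x)), a'; rewrite Nat.add_succ_r, <- !Rplus_assoc.
    split; [lra|]; split; [lra|]; split.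
    { destruct Px as [X1 X2], Py as [Y1 Y2]; split; lra. }
    split; [exact Pp'|]; apply Ps'; auto.
    + apply Rmult_le_pos; lra.
    + assert (0 <= D * cos (opening phi)) by (apply Rmult_le_pos; lra); lra. }
destruct (Hm (n' - n)%nat) as (_ & x & a & Hx & Ha & Px & Pp & Ps); [lia|].
replace (n + (n' - n))%nat with n' in * by lia.
exists n', a, x, D; split; [exact An'|]; split.
{ destruct (pose_direction _ _ _ _ _ _ _ HP) as (D' & HD' & Hal' & PD').
  destruct (polar_unique (l n) (u n) D D' al al); auto; lra. }
split; [exact Hx|]; split.
{ destruct (moves_cycle _ _ _ _ (lower_moves _ _ _ _ _ _ _ _ HS) n n')
    as [E1|E1]; [repeat split; auto| |].
  - left; rewrite E1 in Px.
    destruct (polar_unique (tl n) (l n) D x b b); auto; lra.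
  - right.
    rewrite (polar_dist (l n) (l n') x (b + PI)) in E1; auto; try lra.
    apply polar_opp; exact Px. }
split; [exact Pp|]; split; [exact Ha|].
destruct Pp as (V & be & G & ga & D' & _ & _ & (Hb & Hbe & Hga) & Hal' & _).
apply swept_angle; try (unfold b, opening in *; lra).
destruct Ps as [_ Ps].
replace (opening phi - (al - a)) with (a - b) by (unfold b; ring).
lra.
Qed.

(** The potential [E * exp (2 * al / sin (opening phi))] bounds all distances by [K], which makes
    the decrement of [al] independent of the cycle. *)
Lemma system_rotation_progress phi delta l u tl tu AL AU n al E K :
  0 <= phi < PI / 6 -> 0 < delta -> system phi delta l u tl tu AL AU ->
  rotating phi l u tl tu AL n al E ->
  E * exp (2 * al / sin (opening phi)) <= K ->
  exists n' b' al' E', AL n' /\ pose phi b' al' E' (l n') (tu n') (u n') /\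
    al' <= al - Rmin 1 (delta / K) * sin (opening phi) / 2 /\
    E' * exp (2 * al' / sin (opening phi)) <= K.
Proof.
intros Hphi Hdelta HS HR HK.
assert (Hal : 0 <= al).
{ destruct HR as (_ & h & _); unfold opening in h; lra. }
destruct (system_rotation phi delta l u tl tu AL AU n al E)
  as (n' & al' & x & D & An & HD & Hx & Hxd & HP & Ha & Hsw); auto.
pose proof (sin_opening_pos phi Hphi) as Hsin.
set (s := sin (opening phi)) in *.
exists n', (al - opening phi), al', (E + x).
split; [exact An|]; split; [exact HP|].
assert (H0 : 0 <= 2 * al / s)
  by (apply Rmult_le_pos; [lra|apply Rlt_le, Rinv_0_lt_compat; lra]).
assert (HEK : E <= K).
{ pose proof (exp_ineq1_le (2 * al / s)).
  assert (E * 1 <= E * exp (2 * al / s)) by (apply Rmult_le_compat_l; lra); lra. }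
split.
(* A cycle cut short still has [x >= delta], and [D <= E <= K] turns this into a fixed fraction of
   [D]. *)
- assert (Hmin : Rmin 1 (delta / K) * D <= x).
  { destruct Hxd as [->|Hxd].
    - pose proof (Rmin_l 1 (delta / K)).
      assert (Rmin 1 (delta / K) * D <= 1 * D) by (apply Rmult_le_compat_r; lra); lra.
    - pose proof (Rmin_r 1 (delta / K)).
      apply Rle_trans with (delta / K * D); [apply Rmult_le_compat_r; lra|].
      apply Rle_trans with (delta / K * K).
      + apply Rmult_le_compat_l; [|lra].
        apply Rmult_le_pos; [lra|apply Rlt_le, Rinv_0_lt_compat; lra].
      + unfold Rdiv; rewrite Rmult_assoc, Rinv_l; lra. }
  assert (Rmin 1 (delta / K) * D * s <= x * s) by (apply Rmult_le_compat_r; lra).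
  assert (D * (Rmin 1 (delta / K) * s) <= D * (2 * (al - al'))) by lra.
  assert (Rmin 1 (delta / K) * s <= 2 * (al - al'))
    by (apply (Rmult_le_reg_l D); lra).
  lra.
- apply Rle_trans with (2 := HK).
  (* Since [x <= D * d <= E * d], the new bound is at most [E * (1 + d) <= E * exp d], which the
     drop of [al] compensates. *)
  set (d := 2 * (al - al') / s).
  replace (2 * al / s) with (d + 2 * al' / s) by (unfold d; field; lra).
  rewrite exp_plus, <- Rmult_assoc.
  apply Rmult_le_compat_r; [apply Rlt_le, exp_pos|].
  assert (E * (1 + d) <= E * exp d)
    by (apply Rmult_le_compat_l; [lra|apply exp_ineq1_le]).
  assert (x <= D * d).
  { apply (Rmult_le_reg_r s); [lra|].
    replace (D * d * s) with (2 * D * (al - al')) by (unfold d; field; lra).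
    exact Hsw. }
  assert (0 <= d)
    by (apply Rmult_le_pos; [lra|apply Rlt_le, Rinv_0_lt_compat; lra]).
  assert (D * d <= E * d) by (apply Rmult_le_compat_r; lra).
  lra.
Qed.

(** * Cycles of L without rotation *)

(** The path through [q] closes up although its two legs differ in direction by less than [PI]; both
    legs are therefore zero. *)
Lemma pose_coincident (phi b al E : R) (p q : point) :
  pose phi b al E p q p -> q = p.
Proof.
intros (V & be & G & ga & D & (PV & PG & PD) & (HV & HG & HD & HE) &
  (Hb & Hbe & Hga) & Hal & Hg).
pose proof (polar_radius _ _ _ _ _ _ _ _ be PV PG (proj2 (polar_zero p p be) eq_refl)) as E1.
pose proof (polar_radius _ _ _ _ _ _ _ _ ga PV PG (proj2 (polar_zero p p ga) eq_refl)) as E2.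
replace (be - ga) with (- (ga - be)) in E2 by ring; rewrite cos_neg in E2.
replace (be - be) with 0 in E1 by ring; replace (ga - ga) with 0 in E2 by ring.
rewrite cos_0 in E1, E2.
assert (-1 < cos (ga - be)) by (rewrite <- cos_PI; apply cos_decreasing_1; lra).
assert (V = 0) as -> by nra.
apply polar_zero in PV; exact PV.
Qed.

Lemma pose_refl (phi E : R) (p : point) :
  0 <= phi < PI / 6 -> 0 <= E -> pose phi 0 0 E p p p.
Proof.
intros Hphi HE; exists 0, 0, 0, 0, 0; repeat split; simpl; try lra.
Qed.

Lemma forever_or (P Q : nat -> Prop) (n : nat) :
  P n -> (forall m, (n <= m)%nat -> P m -> P (S m) \/ Q (S m)) ->
  (exists m, Q m) \/ forall m, (n <= m)%nat -> P m.
Proof.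
intros Pn Hstep; destruct (classic (exists m, Q m)) as [h|h]; [left; exact h|].
right; intros m Hm; induction Hm as [|m Hm IH]; [exact Pn|].
destruct (Hstep m Hm IH); [assumption|exfalso; eauto].
Qed.

(** Since [al <= PI / 3 < PI / 2 - phi], L cannot approach, and each look of U targets the position
    of L. Either L rotates at some later time, or it stays forever and U homes in on it. *)
Lemma system_waiting phi delta l u tl tu AL AU n b al E :
  0 <= phi < PI / 6 -> 0 < delta -> system phi delta l u tl tu AL AU ->
  pose phi b al E (l n) (tu n) (u n) -> tl n = l n -> al <= PI / 3 ->
  meet l u \/ exists m al', al' <= al /\ rotating phi l u tl tu AL m al' E.
Proof.
intros Hphi Hdelta HS HP Ht Hal.
destruct (forever_or
  (fun m => tl m = l m /\ l m = l n /\
     exists b a, a <= al /\ pose phi b a E (l m) (tu m) (u m))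
  (fun m => exists a, a <= al /\ rotating phi l u tl tu AL m a E) n)
  as [[m (a & H)]|Hw].
- split; [exact Ht|]; split; [reflexivity|]; exists b, al; split; [lra|exact HP].
- intros m Hm (Tm & Lm & b1 & a1 & Ha1 & P1).
  destruct (system_step_still _ _ _ _ _ _ _ _ _ _ _ _ Hphi HS P1 Tm)
    as (E1 & a2 & Ha2 & P2).
  assert (Hkeep : tl (S m) = l (S m) ->
    tl (S m) = l (S m) /\ l (S m) = l n /\ exists b a, a <= al /\
      pose phi b a E (l (S m)) (tu (S m)) (u (S m))).
  { intros h; split; [exact h|]; split; [congruence|].
    exists b1, a2; split; [lra|exact P2]. }
  destruct (classic (AL (S m))) as [h|h].
  + destruct (pose_direction _ _ _ _ _ _ _ P2) as (D & HD & Hal2 & PD).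
    destruct (lower_looks _ _ _ _ _ _ _ _ HS (S m) D a2)
      as [[h1 _]|[[_ h1]|(h1 & h2 & h3)]]; auto; try lra.
    right; exists a2; split; [lra|]; split; [exact h|]; split; [exact h2|].
    split; [|exists D; auto].
    apply (pose_rebase phi b1 _ a2 E E); try (unfold opening in *; lra); auto.
    destruct P2 as (V & be & G & ga & D2 & _ & _ & ? & ? & _).
    unfold opening in *; lra.
  + left; apply Hkeep.
    rewrite (moves_keep _ _ _ _ (lower_moves _ _ _ _ _ _ _ _ HS) m h); congruence.
- right; exists m, a; exact H.
- left.
  (* Before its look at [n1], U may still pursue an older target. *)
  destruct (moves_fair _ _ _ _ (upper_moves _ _ _ _ _ _ _ _ HS) n) as (n1 & L1 & A1).
  assert (Hlook : forall m, (n <= m)%nat -> AU m -> tu m = l n).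
  { intros m Hm Am; destruct (Hw m Hm) as (_ & Lm & b1 & a1 & Ha1 & P1).
    destruct (pose_direction _ _ _ _ _ _ _ P1) as (D & HD & Hal2 & PD).
    destruct (upper_looks _ _ _ _ _ _ _ _ HS m D a1)
      as [[h _]|[h [h1|h1]]]; auto; try lra; try congruence.
    rewrite h1 in PD; apply polar_zero in PD; congruence. }
  destruct (homing delta u tu AU (l n) n1) as (f & Hf); auto.
  + apply HS.
  + intros m Hm; induction Hm as [|m Hm IH]; [apply Hlook; auto|].
    destruct (classic (AU (S m))) as [h|h]; [apply Hlook; auto; lia|].
    rewrite (moves_keep _ _ _ _ (upper_moves _ _ _ _ _ _ _ _ HS) m h); exact IH.
  + exists (l n), (Nat.max n f); intros m Hm; split.
    * apply Hw; lia.
    * apply Hf; lia.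
Qed.

(** Since [al >= 2 * PI / 3 > PI / 2 + phi], U has no move pending and every look makes it wait. L
    heads straight for U, which preserves the direction [al]; unless it rotates at some point, it
    homes in on U. *)
Lemma system_approaching phi delta l u tl tu AL AU n b al E :
  0 <= phi < PI / 6 -> 0 < delta -> system phi delta l u tl tu AL AU ->
  pose phi b al E (l n) (tu n) (u n) -> tl n = u n -> 2 * PI / 3 <= al ->
  meet l u \/ exists m, rotating phi l u tl tu AL m al E.
Proof.
intros Hphi Hdelta HS HP Ht Hal.
assert (Hal2 : al < PI)
  by (destruct (pose_direction _ _ _ _ _ _ _ HP) as (D & _ & h & _); lra).
destruct (forever_or
  (fun m => u m = u n /\ tu m = u n /\ tl m = u n /\
     exists D, 0 <= D <= E /\ polar (l m) (u n) D al)
  (fun m => rotating phi l u tl tu AL m al E) n) as [H|Hw].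
- split; [reflexivity|]; split; [|split; [exact Ht|]].
  + destruct HP as (V & be & G & ga & D & (_ & PG & _) & _ & (_ & _ & Hga) & _ & Hg).
    destruct Hg as [->|Hg]; [|lra].
    apply polar_zero in PG; congruence.
  + destruct (pose_direction _ _ _ _ _ _ _ HP) as (D & HD & _ & PD); eauto.
- intros m Hm (Um & Tum & Tlm & D & HD & PD).
  destruct (moves_step _ _ _ _ (upper_moves _ _ _ _ _ _ _ _ HS) m) as (k & _ & Ek).
  destruct (moves_step _ _ _ _ (lower_moves _ _ _ _ _ _ _ _ HS) m) as (k' & Hk & Ek').
  assert (U1 : u (S m) = u n)
    by (rewrite Ek, Um, Tum; apply point_eq; simpl; ring).
  assert (P1 : polar (l (S m)) (u n) ((1 - k') * D) al).
  { rewrite Ek', Tlm; destruct PD as [D1 D2]; split; simpl; rewrite ?D1, ?D2; ring. }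
  assert (HD1 : 0 <= (1 - k') * D <= E).
  { assert (0 <= k' * D) by (apply Rmult_le_pos; lra).
    assert (0 <= (1 - k') * D) by (apply Rmult_le_pos; lra); lra. }
  assert (T1 : tu (S m) = u n).
  { destruct (classic (AU (S m))) as [h|h].
    - destruct (upper_looks _ _ _ _ _ _ _ _ HS (S m) ((1 - k') * D) al)
        as [[_ h1]|[h1 _]]; auto; try lra; try congruence.
    - rewrite (moves_keep _ _ _ _ (upper_moves _ _ _ _ _ _ _ _ HS) m h); exact Tum. }
  assert (Hkeep : tl (S m) = u n -> u (S m) = u n /\ tu (S m) = u n /\
    tl (S m) = u n /\ exists D, 0 <= D <= E /\ polar (l (S m)) (u n) D al).
  { intros h; split; [exact U1|]; split; [exact T1|]; split; [exact h|]; eauto. }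
  destruct (classic (AL (S m))) as [h|h].
  + rewrite <- U1 in P1.
    destruct (lower_looks _ _ _ _ _ _ _ _ HS (S m) ((1 - k') * D) al)
      as [[h1 [h2|h2]]|[[h1 _]|(h1 & h2 & h3)]]; auto; try lra.
    (* At distance 0, waiting and approaching have the same destination. *)
    * left; apply Hkeep; rewrite h2 in P1; apply polar_zero in P1; congruence.
    * left; apply Hkeep; congruence.
    * right; split; [exact h|]; split; [exact h2|]; split; [|eauto].
      rewrite T1, <- U1.
      exists ((1 - k') * D), al, 0, al, ((1 - k') * D).
      unfold opening in *.
      repeat split; try lra; try apply P1.
  + left; apply Hkeep.
    rewrite (moves_keep _ _ _ _ (lower_moves _ _ _ _ _ _ _ _ HS) m h); exact Tlm.
- right; exact H.
- left.
  destruct (homing delta l tl AL (u n) n) as (f & Hf); auto.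
  + apply HS.
  + intros m Hm; apply Hw; exact Hm.
  + exists (u n), (Nat.max n f); intros m Hm; split.
    * apply Hf; lia.
    * apply Hw; lia.
Qed.

Lemma system_active phi delta l u tl tu AL AU n b al E :
  0 <= phi < PI / 6 -> 0 < delta -> system phi delta l u tl tu AL AU ->
  AL n -> pose phi b al E (l n) (tu n) (u n) ->
  meet l u \/ exists m al', al' <= al /\ rotating phi l u tl tu AL m al' E.
Proof.
intros Hphi Hdelta HS An HP.
destruct (pose_direction _ _ _ _ _ _ _ HP) as (D & HD & Hal & PD).
destruct (lower_looks _ _ _ _ _ _ _ _ HS n D al)
  as [[h1 [h2|h2]]|[[h1 h2]|(h1 & h2 & h3)]]; auto; try lra.
(* Coincident robots leave the angle free, so it is reset to 0, where L waits. *)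
- rewrite h2 in PD; apply polar_zero in PD.
  pose proof HP as HP'; rewrite PD in HP'; apply pose_coincident in HP'.
  destruct (system_waiting phi delta l u tl tu AL AU n 0 0 E) as [H|(m & a & Ha & H)];
    auto; try lra.
  + rewrite HP', PD; apply pose_refl; lra.
  + right; exists m, a; split; [lra|exact H].
- eapply system_waiting; eauto.
- destruct (system_approaching phi delta l u tl tu AL AU n b al E) as [H|(m & H)]; auto.
  right; exists m, al; split; [lra|exact H].
- right; exists n, al; split; [lra|]; split; [exact An|]; split; [exact h2|].
  split; [|eauto].
  apply (pose_rebase phi b _ al E E); try (unfold opening in *; lra); auto.
  destruct HP as (V & be & G & ga & D2 & _ & _ & ? & ? & _).
  unfold opening in *; lra.
Qed.

(** * Finiteness of the rotations and choice of the lower robot *)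

Lemma system_meet phi delta l u tl tu AL AU D al :
  0 <= phi < PI / 6 -> 0 < delta -> system phi delta l u tl tu AL AU ->
  0 <= D -> 0 <= al < PI -> polar (l 0%nat) (u 0%nat) D al -> meet l u.
Proof.
intros Hphi Hdelta HS HD Hal PD.
pose proof (sin_opening_pos phi Hphi) as Hsin.
(* No rotation has fixed [b] yet; the maximum keeps it nonnegative and within the opening of
   [al]. *)
assert (P0 : pose phi (Rmax 0 (al - opening phi)) al D (l 0%nat) (tu 0%nat) (u 0%nat)).
{ assert (HR : 0 <= Rmax 0 (al - opening phi) <= al /\
    al - opening phi <= Rmax 0 (al - opening phi))
    by (unfold Rmax, opening; destruct Rle_dec; lra).
  set (b := Rmax 0 (al - opening phi)) in *; unfold opening in HR.
  assert (Pu : pose phi b al D (l 0%nat) (u 0%nat) (u 0%nat)).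
  { exists D, al, 0, al, D; repeat split; try lra; apply PD. }
  destruct (classic (AU 0%nat)) as [h|h].
  - apply (pose_observe_upper _ _ _ _ _ (u 0%nat)); auto.
    destruct (upper_looks _ _ _ _ _ _ _ _ HS 0%nat D al) as [H|[H _]]; tauto.
  - rewrite (moves_idle _ _ _ _ (upper_moves _ _ _ _ _ _ _ _ HS) h); exact Pu. }
assert (Hfirst : exists n0, AL n0 /\ forall s, (s < n0)%nat -> ~ AL s).
{ destruct (classic (AL 0%nat)) as [h|h].
  - exists 0%nat; split; [exact h|lia].
  - destruct (next_activation AL 0 (moves_fair _ _ _ _ (lower_moves _ _ _ _ _ _ _ _ HS)))
      as (t & _ & At & Nt).
    exists t; split; [exact At|]; intros [|s] Hs; [exact h|apply Nt; lia]. }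
destruct Hfirst as (n0 & A0 & N0).
assert (Hidle : forall n, (n <= n0)%nat -> ((n < n0)%nat -> tl n = l n) /\
  exists b a, pose phi b a D (l n) (tu n) (u n)).
{ induction n as [|n IH]; intros Hn.
  - split; [|eauto].
    intros h; apply (moves_idle _ _ _ _ (lower_moves _ _ _ _ _ _ _ _ HS)); auto.
  - destruct IH as (IHt & b & a & IHp); [lia|].
    destruct (system_step_still _ _ _ _ _ _ _ _ _ _ _ _ Hphi HS IHp (IHt Hn))
      as (El & a' & _ & Pa).
    split; [|eauto].
    intros h; rewrite (moves_keep _ _ _ _ (lower_moves _ _ _ _ _ _ _ _ HS) n) by auto.
    rewrite El; auto. }
destruct (Hidle n0 (le_n _)) as (_ & b & a & Pa).
(* The maximum with 1 keeps [K] positive when [D = 0]. *)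
set (K := Rmax 1 (D * exp (2 * a / sin (opening phi)))).
set (c := Rmin 1 (delta / K) * sin (opening phi) / 2).
assert (HK : 0 < K) by (pose proof (Rmax_l 1 (D * exp (2 * a / sin (opening phi)))); fold K in H; lra).
assert (Hc : 0 < c).
{ unfold c; apply Rmult_lt_0_compat; [|lra]; apply Rmult_lt_0_compat; [|lra].
  apply Rmin_glb_lt; [lra|]; apply Rmult_lt_0_compat; [lra|].
  apply Rinv_0_lt_compat; lra. }
(* Each completed rotation lowers [a] by at least [c] while [a] stays nonnegative, so
   [a < INR j * c] leaves room for fewer than [j] of them. *)
assert (Hind : forall (j n : nat) (b a E : R), AL n ->
  pose phi b a E (l n) (tu n) (u n) ->
  E * exp (2 * a / sin (opening phi)) <= K -> a < INR j * c -> meet l u).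
{ induction j as [|j IH]; intros n b1 a1 E An HP HE Ha.
  - destruct (pose_direction _ _ _ _ _ _ _ HP) as (D' & _ & h & _); simpl in Ha; lra.
  - destruct (system_active phi delta l u tl tu AL AU n b1 a1 E)
      as [H|(m & a2 & Ha2 & HR)]; auto.
    assert (HE2 : E * exp (2 * a2 / sin (opening phi)) <= K).
    { apply Rle_trans with (2 := HE); apply Rmult_le_compat_l.
      - destruct (pose_direction _ _ _ _ _ _ _ HP) as (D' & h & _); lra.
      - assert (2 * a2 / sin (opening phi) <= 2 * a1 / sin (opening phi)) as [h|h].
        + apply Rmult_le_compat_r; [apply Rlt_le, Rinv_0_lt_compat; lra|lra].
        + apply Rlt_le, exp_increasing, h.
        + rewrite h; lra. }
    destruct (system_rotation_progress phi delta l u tl tu AL AU m a2 E K)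
      as (n' & b' & a' & E' & An' & HP' & Ha' & HE'); auto.
    apply (IH n' b' a' E'); auto.
    rewrite S_INR in Ha; unfold c in *; lra. }
destruct (INR_unbounded (a / c)) as [j Hj].
apply (Hind j n0 b a D); auto.
- apply Rmax_r.
- apply (Rmult_lt_compat_r c) in Hj; [|lra].
  unfold Rdiv in Hj; rewrite Rmult_assoc, Rinv_l, Rmult_1_r in Hj; lra.
Qed.

Lemma run_meet (phi delta : R) (e : run) (i : robot) (D al : R) :
  0 <= phi < PI / 6 -> 0 < delta -> async_run (A_AD phi) phi delta e ->
  0 <= D -> 0 <= al < PI ->
  polar (traj e i (INR 0)) (traj e (negb i) (INR 0)) D al ->
  meet (fun n => traj e i (INR n)) (fun n => traj e (negb i) (INR n)).
Proof.
intros Hphi Hdelta He HD Hal PD.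
destruct (run_moves _ _ _ _ i He) as (tl & Ml & Ll).
destruct (run_moves _ _ _ _ (negb i) He) as (tu & Mu & Lu).
destruct (async_compasses _ _ _ _ He) as [Hdev _].
apply (system_meet phi delta _ _ tl tu (active e i) (active e (negb i)) D al); auto.
split; auto.
- intros n D' a An HD' Ha P.
  apply (lower_look phi (scaling e i n) (deviation e i n)); try assumption.
  + apply (async_scaling _ _ _ _ He).
  + apply Hdev.
  + apply (Ll n An).
- intros n D' a An HD' Ha P.
  apply (upper_look phi (scaling e (negb i) n) (deviation e (negb i) n)); try assumption.
  + apply (async_scaling _ _ _ _ He).
  + apply Hdev.
  + pose proof (Lu n An) as H; rewrite Bool.negb_involutive in H; exact H.
Qed.

Theorem theorem6 (phi delta : R) (hphi : 0 <= phi < PI / 6) (hdelta : 0 < delta) :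
  gathering_algorithm phi delta (A_AD phi).
Proof.
intros C0 C (e & He & HC) _.
destruct (polar_exists (traj e false (INR 0)) (traj e true (INR 0)))
  as (D & a & HD & Ha & PD).
(* Exactly one of the two opposite directions between the robots lies in [0, PI) modulo a turn; it
   designates the lower robot for the whole run. *)
destruct (Rlt_le_dec a 0) as [h|h]; [|destruct (Rlt_le_dec a PI) as [h'|h']].
- destruct (run_meet phi delta e true D (a + PI)) as (p & f & Hf); auto; try lra.
  { apply polar_opp; exact PD. }
  exists p, f; intros t Ht; rewrite HC; destruct (Hf t Ht) as [H1 H2].
  simpl in H2; congruence.
- destruct (run_meet phi delta e false D a) as (p & f & Hf); auto.
  exists p, f; intros t Ht; rewrite HC; destruct (Hf t Ht) as [H1 H2].
  simpl in H2; congruence.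
- destruct (run_meet phi delta e true D (a - PI)) as (p & f & Hf); auto; try lra.
  { apply polar_opp, polar_period in PD.
    replace (a - PI) with (a + PI - 2 * PI) by ring; exact PD. }
  exists p, f; intros t Ht; rewrite HC; destruct (Hf t Ht) as [H1 H2].
  simpl in H2; congruence.
Qed.
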